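(* Let $u,v\ge 1$ be integers and let $z$ be an indeterminate. For every integer $n\ge 0$ and every $i=1,2,\dots,2^n$: if $c_z^{(u,v)}(n,i)=\dfrac{az+b}{cz+d}$ in $\mathbb{Q}(z)$, where $a,b,c,d$ are nonnegative integers, then \[ c_z^{(u,v)}(n,2^n+1-i)=\frac{dz+\dfrac{cv}{u}}{\dfrac{bu}{v}z+a}. \]
   Context: For integers $u,v\ge 1$ and an indeterminate $z$, the $(u,v)$-Calkin–Wilf tree $\mathcal{T}^{(u,v)}(z)$ is the infinite binary tree with root $z$, whose vertices are elements of $\mathbb{Q}(z)$, in which every vertex $w$ has left child $w/(uw+1)$ and right child $w+v$. Rows are numbered from $0$ (row $0$ is the root), so row $n$ has $2^n$ vertices; $c_z^{(u,v)}(n,i)$ denotes the $i$-th vertex from the left in row $n$ (the left and right children of the $k$-th vertex of row $n$ are the $(2k-1)$-th and $2k$-th vertices of row $n+1$). *)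

(* Defs.v *)
From mathcomp Require Import all_boot all_order all_algebra.

Set Implicit Arguments.
Unset Strict Implicit.
Unset Printing Implicit Defensive.

Import GRing.Theory.
Local Open Scope ring_scope.

(* The field Q(z), with its indeterminate. *)
Definition Qz : fieldType := {fraction {poly rat}}.
Definition indet : Qz := @FracField.tofrac {poly rat} 'X.

Definition cw_left (u : nat) (w : Qz) : Qz := w / (u%:R * w + 1).
Definition cw_right (v : nat) (w : Qz) : Qz := w + v%:R.

(* Vertices are numbered from 1 in each row; only the values at
   1 <= i <= 2 ^ n are meaningful. The parent of vertex i of row n.+1 is vertex
   uphalf i of row n, since uphalf (2k - 1) = uphalf (2k) = k. *)
Fixpoint cw_vertex (u v : nat) (n i : nat) : Qz :=
  match n with
  | 0 => indet
  | n'.+1 =>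
      let w := cw_vertex u v n' (uphalf i) in
      if odd i then cw_left u w else cw_right v w
  end.

Lemma cw_vertex_left u v n k : (0 < k)%N ->
  cw_vertex u v n.+1 (2 * k - 1) = cw_left u (cw_vertex u v n k).
Proof.
case: k => // k _; rewrite mul2n doubleS subn1 /=.
by rewrite odd_double doubleK.
Qed.

Lemma cw_vertex_right u v n k :
  cw_vertex u v n.+1 (2 * k) = cw_right v (cw_vertex u v n k).
Proof. by rewrite mul2n /= odd_double uphalf_double. Qed.

(* Main.v *)
Require Import Defs.
From mathcomp Require Import all_boot all_order all_algebra.
From mathcomp Require Import zify ring.

Import GRing.Theory.
Local Open Scope ring_scope.

(** Vertices are the Moebius images of [z] under products of L = [[1,0],[u,1]]
    and R = [[1,v],[0,1]], and conjugation by P = [[0,v],[u,0]] swaps L and R,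
    hence reflects each row: M z and (P M P^-1) z are mirror vertices, where
    P [[a,b],[c,d]] P^-1 = [[d,cv/u],[bu/v,a]]. An arbitrary representation
    (az+b)/(cz+d) of a vertex is compared with the one coming from M by cross
    multiplication: the three coefficient identities expressing equality of the
    two fractions are also those expressing equality of the two conjugates. *)

(** [indet] is transcendental over the rationals: both sides are images of polynomials under the
    injective [tofrac], so coefficients agree in [rat], hence in [nat] by characteristic 0. *)
Lemma indet_quadratic_inj (a b c a' b' c' : nat) :
  a%:R * indet ^+ 2 + b%:R * indet + c%:R
    = a'%:R * indet ^+ 2 + b'%:R * indet + c'%:R ->
  [/\ a = a', b = b' & c = c'].
Proof.
have toE (p q r : nat) : p%:R * indet ^+ 2 + q%:R * indet + r%:R
    = FracField.tofrac (p%:R *: 'X^2 + q%:R *: 'X + r%:R%:P : {poly rat}).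
  rewrite /indet !rmorphD -!mul_polyC !rmorphM /= -expr2.
  by rewrite !polyC_natr !rmorph_nat.
rewrite !toE => /eqP; rewrite tofrac_eq => /eqP E.
have coefE k := congr1 (fun p : {poly rat} => p`_k) E.
move: (coefE 0%N) (coefE 1%N) (coefE 2%N).
rewrite !coefD !coefZ !coefXn !coefX !coefC /= ?(mulr0, mulr1, addr0, add0r).
by move=> /eqP + /eqP + /eqP; rewrite !Num.Theory.eqr_nat => /eqP-> /eqP-> /eqP->.
Qed.

Lemma indet_linear_neq0 (a b : nat) :
  (0 < a + b)%N -> a%:R * indet + b%:R != 0.
Proof.
move=> ab_gt0; apply/eqP => E.
have [] := @indet_quadratic_inj 0 a b 0 0 0; last by lia.
by rewrite !mul0r !add0r E.
Qed.

Lemma Qz_natr_neq0 (n : nat) : (0 < n)%N -> (n%:R : Qz) != 0.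
Proof.
by move=> n_gt0; have := @indet_linear_neq0 0 n n_gt0; rewrite mul0r add0r.
Qed.

(* This and the next three lemmas are over an abstract field because [ring] and
   [field] do not terminate in practice on the concrete field [Qz]. *)
Lemma moebius_left (F : fieldType) (z : F) (u v a b c d : nat) :
  (u * c)%:R * z + d%:R != 0 ->
  let w := (a%:R * z + (v * b)%:R) / ((u * c)%:R * z + d%:R) in
  w / (u%:R * w + 1)
    = (a%:R * z + (v * b)%:R) / ((u * (c + a))%:R * z + (d + u * v * b)%:R).
Proof.
move=> y0 /=; set x := a%:R * z + _; set y := _ * z + d%:R in y0 *.
have -> : u%:R * (x / y) + 1 = (u%:R * x + y) / y by field.
rewrite invf_div mulrA mulfVK //; congr (_ / _).
by rewrite /x /y !(natrD, natrM); ring.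
Qed.

Lemma moebius_right (F : fieldType) (z : F) (u v a b c d : nat) :
  (u * c)%:R * z + d%:R != 0 ->
  (a%:R * z + (v * b)%:R) / ((u * c)%:R * z + d%:R) + v%:R
    = ((a + u * v * c)%:R * z + (v * (b + d))%:R) / ((u * c)%:R * z + d%:R).
Proof.
set x := a%:R * z + _; set y := _ * z + d%:R => y0.
have -> : x / y + v%:R = (x + v%:R * y) / y by field.
by congr (_ / _); rewrite /x /y !(natrD, natrM); ring.
Qed.

Lemma linear_product_coefs (F : fieldType) (z p q r s p' q' r' s' : F) :
  (p * z + q) * (r * z + s) = (p' * z + q') * (r' * z + s') ->
  p * r * z ^+ 2 + (p * s + q * r) * z + q * s
    = p' * r' * z ^+ 2 + (p' * s' + q' * r') * z + q' * s'.
Proof.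
have prodE (p0 q0 r0 s0 : F) : p0 * r0 * z ^+ 2 + (p0 * s0 + q0 * r0) * z + q0 * s0
    = (p0 * z + q0) * (r0 * z + s0) by ring.
by rewrite !prodE.
Qed.

Lemma moebius_conj_eq (F : fieldType) (z u v a b c d a' b' c' d' : F) :
  u != 0 -> v != 0 -> u * b' * z + a' != 0 -> b * u / v * z + a != 0 ->
  a * (u * c') = a' * c ->
  a * d' + b * (u * c') = a' * d + v * b' * c ->
  b * d' = v * b' * d ->
  (d' * z + v * c') / (u * b' * z + a')
    = (d * z + c * v / u) / (b * u / v * z + a).
Proof.
move=> u0 v0 y0 y0' E2 E1 E0; apply/eqP; rewrite eqr_div //; apply/eqP.
(* The [z ^+ 2] and constant coefficients are [E0] and [E2] rescaled by [u / v] and [v / u]; the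
   middle one is [E1] itself. *)
have cross : (d' * z + v * c') * (b * u / v * z + a)
      - (d * z + c * v / u) * (u * b' * z + a')
    = u / v * (b * d' - v * b' * d) * z ^+ 2
      + (a * d' + b * (u * c') - (a' * d + v * b' * c)) * z
      + v / u * (a * (u * c') - a' * c).
  by field; rewrite u0.
by apply/eqP; rewrite -subr_eq0 cross E2 E1 E0 !subrr !(mulr0, mul0r, addr0).
Qed.

(* The matrix is [[a, v b], [u c, d]], of determinant 1. *)
Lemma cw_vertex_mirror (u v n i : nat) : (1 <= i <= 2 ^ n)%N ->
  exists a b c d : nat,
  [/\ (a * d = (u * v * b * c).+1)%N,
      cw_vertex u v n i
        = (a%:R * indet + (v * b)%:R) / ((u * c)%:R * indet + d%:R)
    & cw_vertex u v n (2 ^ n + 1 - i)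
        = (d%:R * indet + (v * c)%:R) / ((u * b)%:R * indet + a%:R)].
Proof.
elim: n i => [|n IHn] i hi.
  exists 1%N, 0%N, 0%N, 1%N; split; first by lia.
    by rewrite !muln0 mul1r mul0r add0r addr0 divr1.
  by rewrite !muln0 mul1r mul0r add0r addr0 divr1.
have hk : (1 <= uphalf i <= 2 ^ n)%N by rewrite expnS in hi; lia.
have [a [b [c [d [det wE wE']]]]] := IHn _ hk.
(* Since [2 ^ n.+1 + 1] is odd, reflection swaps left and right children; the parent of the mirror
   is the mirror of the parent. *)
have mirror_odd : odd (2 ^ n.+1 + 1 - i) = ~~ odd i.
  by rewrite expnS in hi *; lia.
have mirror_uphalf : uphalf (2 ^ n.+1 + 1 - i) = (2 ^ n + 1 - uphalf i)%N.
  by rewrite expnS in hi *; lia.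
(* The determinant relation makes [a] and [d] positive. *)
have den0 : (u * c)%:R * indet + d%:R != 0 by apply: indet_linear_neq0; nia.
have den0' : (u * b)%:R * indet + a%:R != 0 by apply: indet_linear_neq0; nia.
rewrite /= -/(cw_vertex u v n) mirror_odd mirror_uphalf wE wE'.
case: (odd i) => /=.
  (* L adds [u] times row one to row two; on the mirror matrix, R adds [v] times row two to row
     one. *)
  exists a, b, (c + a)%N, (d + u * v * b)%N; split; first by nia.
    by rewrite /cw_left moebius_left.
  by rewrite /cw_right moebius_right.
exists (a + u * v * c)%N, (b + d)%N, c, d; split; first by nia.
  by rewrite /cw_right moebius_right.
by rewrite /cw_left moebius_left.
Qed.

Theorem theorem4p2 (u v : nat) (hu : (1 <= u)%N) (hv : (1 <= v)%N)
    (n i : nat) (hi : (1 <= i <= 2 ^ n)%N) (a b c d : nat)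
    (hden : c%:R * indet + d%:R != 0)
    (hc : cw_vertex u v n i
          = (a%:R * indet + b%:R) / (c%:R * indet + d%:R)) :
  cw_vertex u v n (2 ^ n + 1 - i)
  = (d%:R * indet + c%:R * v%:R / u%:R)
    / (b%:R * u%:R / v%:R * indet + a%:R).
Proof.
have [a' [b' [c' [d' [det wE ->]]]]] := cw_vertex_mirror u v n i hi.
have u0 := Qz_natr_neq0 u hu; have v0 := Qz_natr_neq0 v hv.
have den0 : (u * c')%:R * indet + d'%:R != 0 by apply: indet_linear_neq0; nia.
have den0' : (u * b')%:R * indet + a'%:R != 0 by apply: indet_linear_neq0; nia.
have num0 : a'%:R * indet + (v * b')%:R != 0 by apply: indet_linear_neq0; nia.
(* Otherwise the vertex would be 0, against [num0]; this keeps the claimed denominator nonzero. *)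
have ab_gt0 : (0 < a + b)%N.
  rewrite lt0n; apply/eqP => ab0.
  have [a0 b0] : a = 0%N /\ b = 0%N by lia.
  move: hc; rewrite a0 b0 wE mul0r addr0 mul0r => /eqP.
  by rewrite mulf_eq0 invr_eq0 (negPf num0) (negPf den0).
have [E2 E1 E0] : [/\ a * (u * c') = a' * c,
    a * d' + b * (u * c') = a' * d + v * b' * c & b * d' = v * b' * d]%N.
  apply: indet_quadratic_inj.
  move: hc; rewrite wE => /eqP; rewrite (eqr_div _ _ den0 hden) => /eqP.
  by rewrite !(natrD, natrM) => E; apply: linear_product_coefs.
have castE m p : m = p -> m%:R = p%:R :> Qz by move->.
move: (castE _ _ E2) (castE _ _ E1) (castE _ _ E0).
rewrite !(natrD, natrM) => {castE E2 E1 E0} E2 E1 E0.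
have den1 : b%:R * u%:R / v%:R * indet + a%:R != 0.
  (* Clearing [v] gives natural coefficients, as [indet_linear_neq0] requires. *)
  have -> : b%:R * u%:R / v%:R * indet + a%:R
      = ((b * u)%:R * indet + (a * v)%:R) / v%:R :> Qz.
    by rewrite !natrM mulrDl mulfK // mulrAC.
  apply: mulf_neq0; last exact: invr_neq0 v0.
  by apply: indet_linear_neq0; nia.
rewrite !natrM in den0' *.
exact: (moebius_conj_eq _ _ _ _ _ _ _ _ _ _ _ _ u0 v0 den0' den1 E2 E1 E0).
Qed.
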